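(* Let $n\ge 0$ and let $f,g\in\Delta$ be homogeneous of degree $n$. Then $\langle f,g\rangle\in 2^{\,n-a(n)}\mathbb Z_{(2)}$, where $a(n)$ is the largest integer $m$ such that $\frac{m(m+1)}{2}\le n$.
   Context: Let $R=\mathbb C[p_1,p_3,p_5,\ldots]$ be the polynomial ring in variables $p_k$ indexed by odd positive integers $k$, graded by giving $p_k$ degree $k$. For a partition $\mu=(\mu_1,\dots,\mu_\ell)$ with all parts odd, set $p_\mu=p_{\mu_1}\cdots p_{\mu_\ell}$ and $z_\mu=\prod_{k\text{ odd}}k^{m_k}m_k!$, where $m_k$ is the multiplicity of $k$ in $\mu$. The bilinear form $\langle\cdot,\cdot\rangle$ on $R$ is the one for which the monomials $p_\mu$ are pairwise orthogonal and $\langle p_\mu,p_\mu\rangle=z_\mu$. Let $\mathbb Z_{(2)}=\{a/b: a,b\in\mathbb Z,\ b\text{ odd}\}$ and $\Delta=\mathbb Z_{(2)}[p_1,2p_3,4p_5,\ldots]=\mathbb Z_{(2)}[2^kp_{2k+1}:k\ge0]\subset R$. *)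

(* Defs.v *)
From HB Require Import structures.
From mathcomp Require Import all_boot all_order all_algebra.
From mathcomp Require Import finmap monalg.

Set Implicit Arguments.
Unset Strict Implicit.
Unset Printing Implicit Defensive.

Import Order.TTheory GRing.Theory Num.Theory.
Local Open Scope ring_scope.

Notation oddnat := {k : nat | odd k}.

Fact odd_doubleS (k : nat) : odd k.*2.+1. Proof. by rewrite /= odd_double. Qed.

(* The odd number 2k + 1. *)
Definition oddn (k : nat) : oddnat := exist (fun j : nat => odd j) k.*2.+1 (odd_doubleS k).

(* A monomial [m : {cmonom oddnat}] is a finitely supported multiplicity
   function, i.e. a partition mu into odd parts in which the part k occurs
   [m k] times; the associated basis vector << m >> is p_mu (lemma [pmonE]). *)
Notation oddpart := {cmonom oddnat}.

Definition psize (m : oddpart) : nat := (\sum_(k <- finsupp m) m k * val k)%N.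

Definition zpart (m : oddpart) : nat :=
  (\prod_(k <- finsupp m) (val k ^ m k * (m k)`!))%N.

(* The polynomial ring C[p_1, p_3, p_5, ...]. *)
Notation oddpoly C := {malg C[oddpart]}.

Lemma malgUM (A : nzRingType) (K : monomType) (x y : K) :
  << mmul x y >> = << x >> * << y >> :> {malg A[K]}.
Proof. by rewrite malgM_def fgmulUU mulr1. Qed.

Lemma malgUX (A : nzRingType) (K : monomType) (x : K) (n : nat) :
  << x >> ^+ n = << iter n (mmul x) mone >> :> {malg A[K]}.
Proof.
elim: n => [|n IH]; first by rewrite expr0.
by rewrite exprS IH -malgUM.
Qed.

Lemma malgU_prod (A : nzRingType) (K : monomType) (I : Type) (s : seq I)
    (F : I -> K) :
  << \big[mmul/mone]_(k <- s) F k >> = \prod_(k <- s) << F k >> :> {malg A[K]}.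
Proof. by elim: s => [|k s IH]; rewrite ?big_nil // !big_cons malgUM IH. Qed.

Lemma cmonomE (I : choiceType) (m : {cmonom I}) :
  m = \big[mmul/mone]_(k <- finsupp m) iter (m k) (mmul (ucm k)) mone.
Proof.
apply/eqP/cmP => i.
have iterE (k : I) n :
    (iter n (mmul (ucm k)) mone : {cmonom I}) i = ((k == i) * n)%N.
  by elim: n => [|n IH] /=; rewrite ?cm1 ?muln0 // cmM IH cmU mulnS.
have -> : forall s : seq I, (\big[mmul/mone]_(k <- s)
     (iter (m k) (mmul (ucm k)) mone : {cmonom I})) i
     = (\sum_(k <- s) (k == i) * m k)%N.
  by elim=> [|k s IH]; rewrite ?big_nil ?cm1 // !big_cons cmM IH iterE.
have [im|im] := boolP (i \in finsupp m).
  rewrite (bigD1_seq i) //= eqxx mul1n big1 ?addn0 // => k /negPf -> //.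
rewrite (fsfun_dflt im) big_seq big1 // => k km.
by case: eqP => // ki; rewrite -ki km in im.
Qed.

Lemma malgU_diag (A : nzRingType) (K : monomType) (z : K -> A) (x y : K) :
  \sum_(k <- msupp (<< x >> : {malg A[K]}))
     (<< x >> : {malg A[K]})@_k * (<< y >> : {malg A[K]})@_k * z k
  = if x == y then z x else 0.
Proof.
rewrite msuppU1 big_seq_fset1 mcoeffUU mcoeffU mul1r eq_sym.
by case: eqP; rewrite (mul1r, mul0r).
Qed.

Section OddPowerSums.
Variable C : numFieldType.
Implicit Types (f g h : oddpoly C) (m : oddpart).

Definition pvar (k : oddnat) : oddpoly C := << (ucm k) >>.

Definition homogeneous (n : nat) f : Prop :=
  forall m, m \in msupp f -> psize m = n.

(* The bilinear form that is diagonal in the basis p_mu with <p_mu, p_mu> = z_mu;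
   see [pformD], [pformZ], [pformC] and [pform_pmon]. *)
Definition pform f g : C := \sum_(m <- msupp f) f@_m * g@_m * (zpart m)%:R.

Definition Z2loc (x : C) : Prop :=
  exists a b : int, odd `|b|%N /\ x = a%:~R / b%:~R.

(* Z_(2)[2^k p_{2k+1} : k >= 0], the Z_(2)-subalgebra generated by the
   2^k p_{2k+1}. *)
Inductive Delta : oddpoly C -> Prop :=
| Delta_const c of Z2loc c : Delta c%:MP
| Delta_gen (k : nat) : Delta (2 ^+ k *: pvar (oddn k))
| Delta_add f g of Delta f & Delta g : Delta (f + g)
| Delta_mul f g of Delta f & Delta g : Delta (f * g).

Lemma pmonE m : << m >> = \prod_(k <- finsupp m) pvar k ^+ m k :> oddpoly C.
Proof.
rewrite [in LHS](cmonomE m) malgU_prod.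
by apply: eq_bigr => k _; rewrite /pvar malgUX.
Qed.

Lemma pformEw (d : {fset oddpart}) f g : (msupp f `<=` d)%fset ->
  pform f g = \sum_(m <- d) f@_m * g@_m * (zpart m)%:R.
Proof.
move=> le; rewrite /pform (big_fset_incl _ le) // => m _ mf.
by rewrite (mcoeff_outdom mf) !mul0r.
Qed.

Lemma pformC f g : pform f g = pform g f.
Proof.
rewrite (pformEw g (fsubsetUl (msupp f) (msupp g))).
rewrite (pformEw f (fsubsetUr (msupp f) (msupp g))).
by apply: eq_bigr => m _; rewrite (mulrC f@_m).
Qed.

Lemma pformD f g h : pform (f + g) h = pform f h + pform g h.
Proof.
rewrite (pformEw h (msuppD_le f g)).
rewrite (pformEw h (fsubsetUl (msupp f) (msupp g))).
rewrite (pformEw h (fsubsetUr (msupp f) (msupp g))).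
by rewrite -big_split; apply: eq_bigr => m _; rewrite mcoeffD !mulrDl.
Qed.

Lemma pformZ c f g : pform (c *: f) g = c * pform f g.
Proof.
rewrite (pformEw g (msuppZ_le c f)) /pform mulr_sumr.
by apply: eq_bigr => m _; rewrite mcoeffZ !mulrA.
Qed.

Lemma pform_pmon (m m' : oddpart) :
  pform << m >> << m' >> = if m == m' then (zpart m)%:R else 0.
Proof. exact: (malgU_diag (fun k : oddpart => (zpart k)%:R)). Qed.

End OddPowerSums.

(* The largest m with m (m + 1) / 2 <= n; such m are at most n. *)
Definition tri_root (n : nat) : nat :=
  \max_(m < n.+1 | (m * m.+1 %/ 2 <= n)%N) m.

Lemma tri_root_le n : (tri_root n * (tri_root n).+1 %/ 2 <= n)%N.
Proof.
rewrite /tri_root; case: (@eq_bigmax_cond _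
  (fun m : 'I_n.+1 => (m * m.+1 %/ 2 <= n)%N) (@nat_of_ord n.+1)) => [|m mP ->] //.
by apply/card_gt0P; exists ord0.
Qed.

Lemma tri_root_max n m : (m * m.+1 %/ 2 <= n)%N -> (m <= tri_root n)%N.
Proof.
move=> mP; have mn : (m < n.+1)%N.
  rewrite ltnS; apply: leq_trans mP; rewrite leq_divRL //.
  by case: m => // m; rewrite leq_mul2l.
exact: (leq_bigmax_cond (Ordinal mn)).
Qed.

(* Main.v *)
Require Import Defs.
From mathcomp Require Import all_boot all_order all_algebra.
From mathcomp Require Import reals complex finmap monalg.
From mathcomp Require Import zify.
Import GRing.Theory Num.Theory.
Local Open Scope ring_scope.

(** The coefficient at [p_mu] of an element of Delta is [2 ^ ((n - l(mu)) / 2)]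
    times an element of Z_(2), so that everything reduces to bounding below the
    2-adic valuation of [2 ^ (n - l(mu)) * z_mu].  By Legendre's formula this
    valuation is [n] minus the total number of binary digits 1 of the
    multiplicities [m_k].  Splitting each [m_k] into powers of 2 (Glaisher's
    bijection) turns mu into a partition of [n] with one distinct part
    [k * 2 ^ i] per such digit, and [j] distinct parts sum to at least
    [j (j + 1) / 2]. *)

(** Positions of the binary digits 1 of [n]; indices below [n] suffice because [n < 2 ^ n]. *)
Definition bits (n : nat) : seq nat := [seq i <- iota 0 n | odd (n %/ 2 ^ i)].

Lemma divn_expS (n i : nat) :
  (n %/ 2 ^ i = odd (n %/ 2 ^ i) + (n %/ 2 ^ i.+1).*2)%N.
Proof. by rewrite expnSr divnMA divn2 odd_double_half. Qed.

Lemma sum_bits (n : nat) : (\sum_(i <- bits n) 2 ^ i = n)%N.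
Proof.
(* Expansion cut off after [j] digits, with remainder [n %/ 2 ^ j]; the remainder vanishes at
   [j = n]. *)
have partial j : (\sum_(0 <= i < j) odd (n %/ 2 ^ i) * 2 ^ i
                  + n %/ 2 ^ j * 2 ^ j = n)%N.
  elim: j => [|j IH]; first by rewrite big_nil divn1 muln1.
  rewrite big_nat_recr //= -[RHS]IH -addnA; congr addn.
  rewrite [in RHS](divn_expS n j) expnS mulnDl -doubleMl mulnCA mul2n.
  by congr (_ + _.*2)%N; rewrite mulnC.
rewrite -[RHS](partial n) (divn_small (ltn_expl n (ltnSn 1))) addn0 big_filter.
rewrite /index_iota subn0 big_mkcond /=.
by apply: eq_bigr => i _; case: odd; rewrite ?mul1n.
Qed.

(** Legendre's formula at 2, in additive form to avoid truncated subtraction. It follows by summing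
    the digit recursion [divn_expS] over all [i]. *)
Lemma size_bits (n : nat) : (size (bits n) + logn 2 n`! = n)%N.
Proof.
have partial j : (\sum_(0 <= i < j) odd (n %/ 2 ^ i)
    + \sum_(1 <= i < j.+1) n %/ 2 ^ i + n %/ 2 ^ j = n)%N.
  elim: j => [|j IH]; first by rewrite !big_geq // divn1.
  rewrite big_nat_recr //= [in X in (_ + X + _)%N]big_nat_recr //=.
  rewrite -[RHS]IH [X in _ = (_ + X)%N](divn_expS n j).
  move: (\sum_(_ <= _ < _) _)%N (\sum_(_ <= _ < _) _)%N => a b.
  move: (n %/ 2 ^ j.+1)%N (nat_of_bool (odd _)) => c d; lia.
rewrite logn_fact // size_filter -sum1_count big_mkcond /=.
rewrite -[RHS](partial n) (divn_small (ltn_expl n (ltnSn 1))) addn0.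
by rewrite /index_iota subn0.
Qed.

Lemma uniq_sum_ge (s : seq nat) : uniq s -> 0%N \notin s ->
  (size s * (size s).+1 <= 2 * \sum_(i <- s) i)%N.
Proof.
move: {2}(size s) (erefl (size s)) => j; elim: j s => [|j IH] s sj us s0.
  by rewrite sj.
(* Pigeonhole: [j + 1] distinct positive numbers cannot all lie in [1..j]. Removing an element above
   [j] leaves a case for the induction. *)
have /hasP[x xs jx] : has (fun x => j < x)%N s.
  apply: contraT => /hasPn sle.
  have := uniq_leq_size us (_ : {subset s <= iota 1 j}).
  rewrite size_iota sj ltnn; apply => x xs.
  rewrite mem_iota add1n ltnS (leqNgt x j) (sle x xs) andbT lt0n.
  by apply: contraNneq s0 => <-.
have := IH (rem x s); rewrite size_rem // sj rem_uniq // => /(_ erefl erefl).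
rewrite (mem_rem_uniq _ us) inE (negPf s0) andbF => /(_ isT) IHx.
rewrite (perm_big _ (perm_to_rem xs)) big_cons /=; lia.
Qed.

Lemma sum_bits_mult_le (m : oddpart) :
  (\sum_(k <- finsupp m) size (bits (m k)) <= tri_root (psize m))%N.
Proof.
pose s := [seq (val k * 2 ^ i)%N | k <- finsupp m, i <- bits (m k)].
have us : uniq s.
  apply: allpairs_uniq_dep => [|k _|]; first exact: fset_uniq.
    by rewrite filter_uniq ?iota_uniq.
  (* As [k] is odd, the 2-adic valuation of [k * 2 ^ i] recovers [i], and then [k]; hence the parts
     are distinct. *)
  have logE (k : oddnat) i : logn 2 (val k * 2 ^ i) = i.
    have k0 : (0 < val k)%N by apply: odd_gt0; exact: valP.
    rewrite lognM ?expn_gt0 // pfactorK // logn_coprime // coprime2n.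
    exact: valP.
  move=> [k i] [k' i'] _ _ /= E.
  have ii' : i = i' by rewrite -(logE k i) E logE.
  subst i'; congr existT; apply: val_inj => /=.
  by move/eqP: E; rewrite eqn_pmul2r ?expn_gt0 // => /eqP.
have s0 : 0%N \notin s.
  apply/negP => /allpairsPdep[k [i [_ _ /esym/eqP]]].
  rewrite muln_eq0 expn_eq0 orbF => /eqP k0.
  by have := valP k; rewrite /= k0.
have sizeE : size s = (\sum_(k <- finsupp m) size (bits (m k)))%N.
  by rewrite size_allpairs_dep sumnE big_map.
have sumE : (\sum_(i <- s) i = psize m)%N.
  rewrite big_allpairs_dep; apply: eq_bigr => k _.
  by rewrite -big_distrr /= sum_bits mulnC.
rewrite -sizeE; apply: tri_root_max.
rewrite leq_divLR ?dvdn2 ?oddM /= ?andbN //.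
by rewrite [leqRHS]mulnC -sumE uniq_sum_ge.
Qed.

(* The exponent of 2 in the monomial [prod_k (2 ^ k p_{2k+1}) ^ m_{2k+1}] of
   Delta; it equals [(n - l(mu)) / 2]. *)
Definition halfsize (m : oddpart) : nat :=
  (\sum_(k <- finsupp m) m k * (val k)./2)%N.

(** Allows the sums for two monomials to run over the support of their product. *)
Lemma halfsizeEw (d : {fset oddnat}) (m : oddpart) : (finsupp m `<=` d)%fset ->
  halfsize m = (\sum_(k <- d) m k * (val k)./2)%N.
Proof.
move=> le; rewrite /halfsize (big_fset_incl _ le) // => k _ km.
by rewrite (fsfun_dflt km).
Qed.

Lemma halfsizeM (m1 m2 : oddpart) :
  halfsize (mmul m1 m2) = (halfsize m1 + halfsize m2)%N.
Proof.
rewrite (halfsizeEw _ _ (fsubsetUl (finsupp m1) (finsupp m2))).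
rewrite (halfsizeEw _ _ (fsubsetUr (finsupp m1) (finsupp m2))).
rewrite /halfsize mdomD -big_split; apply: eq_bigr => k _.
by rewrite cmM mulnDl.
Qed.

Lemma halfsize1 : halfsize mone = 0%N.
Proof. by apply: big1 => k _; rewrite cm1. Qed.

Lemma halfsizeU (k : oddnat) : halfsize (ucm k) = (val k)./2.
Proof. by rewrite /halfsize mdomU big_seq_fset1 cmU eqxx mul1n. Qed.

Lemma dvdn_zpart (m : oddpart) :
  (2 ^ (psize m - tri_root (psize m)) %| 2 ^ (2 * halfsize m) * zpart m)%N.
Proof.
(* The factors [k ^ m k] are odd, so [L] is the 2-adic valuation of [zpart m]. *)
pose L := (\sum_(k <- finsupp m) logn 2 (m k)`!)%N.
have Lz : (2 ^ L %| zpart m)%N.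
  rewrite /L /zpart expn_sum; elim/big_ind2: _ => // [*|k _].
    exact: dvdn_mul.
  by apply: dvdn_mull; exact: pfactor_dvdnn.
apply: (@dvdn_trans (2 ^ (2 * halfsize m + L))); last first.
  by rewrite expnD dvdn_mul.
apply: dvdn_exp2l; rewrite leq_subLR.
apply: (@leq_trans (\sum_(k <- finsupp m) size (bits (m k))
                    + (2 * halfsize m + L))%N).
  2: by rewrite leq_add2r sum_bits_mult_le.
(* Equality holds part by part: [k = 1 + 2 * k./2] for odd [k], and Legendre's formula splits the
   remaining [m k]. *)
apply: eq_leq; rewrite /psize /L /halfsize big_distrr -!big_split /=.
apply: eq_bigr => k _; have := size_bits (m k).
rewrite -{1}(odd_double_half (val k)) (valP k : odd (val k)) mulnDr muln1 -mul2n mulnCA.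
by move: (m k * _)%N (size _) (logn _ _) => h b l <-; lia.
Qed.

Section Z2loc.
Variable C : numFieldType.
Implicit Types x y : C.

Lemma Z2loc_int (a : int) : Z2loc (a%:~R : C).
Proof. by exists a, 1; split=> //; rewrite divr1. Qed.

Lemma Z2loc_nat (n : nat) : Z2loc (n%:R : C).
Proof. exact: (Z2loc_int n). Qed.

Let odd_neq0 (b : int) : odd `|b|%N -> b%:~R != 0 :> C.
Proof. by rewrite intr_eq0; apply: contraTneq => ->. Qed.

Lemma Z2locD x y : Z2loc x -> Z2loc y -> Z2loc (x + y).
Proof.
move=> [a [b [ob ->]]] [c [d [od ->]]].
exists (a * d + c * b), (b * d); rewrite abszM oddM ob od; split=> //.
by rewrite addf_div ?odd_neq0 // !rmorphD !rmorphM.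
Qed.

Lemma Z2locM x y : Z2loc x -> Z2loc y -> Z2loc (x * y).
Proof.
move=> [a [b [ob ->]]] [c [d [od ->]]].
exists (a * c), (b * d); rewrite abszM oddM ob od; split=> //.
by rewrite mulf_div !rmorphM.
Qed.

(** The ideal [2 ^ e Z_(2)], in the form of the final conclusion. *)
Definition pow2Z2loc (e : nat) x : Prop :=
  exists2 c, Z2loc c & x = 2 ^+ e * c.

Lemma pow2Z2loc0 e : pow2Z2loc e 0.
Proof. by exists 0; [exact: (Z2loc_nat 0) | rewrite mulr0]. Qed.

Lemma pow2Z2locD e x y : pow2Z2loc e x -> pow2Z2loc e y -> pow2Z2loc e (x + y).
Proof.
by move=> [c Zc ->] [d Zd ->]; exists (c + d); [exact: Z2locD | rewrite mulrDr].
Qed.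

Lemma pow2Z2locM e e' x y :
  pow2Z2loc e x -> pow2Z2loc e' y -> pow2Z2loc (e + e') (x * y).
Proof.
move=> [c Zc ->] [d Zd ->]; exists (c * d); first exact: Z2locM.
by rewrite exprD mulrACA.
Qed.

Lemma pow2Z2loc_sum e (I : eqType) (r : seq I) (F : I -> C) :
  (forall i, i \in r -> pow2Z2loc e (F i)) -> pow2Z2loc e (\sum_(i <- r) F i).
Proof.
move=> Fe; rewrite big_seq; elim/big_ind: _ => //.
  exact: pow2Z2loc0.
exact: pow2Z2locD.
Qed.

(** Induction on the generation of [Delta]: a generator attains the bound, and products respect it
    because [halfsize] is additive. *)
Lemma Delta_coeff (f : oddpoly C) (m : oddpart) :
  Delta f -> pow2Z2loc (halfsize m) f@_m.
Proof.
move=> Df; elim: Df m => {f} [c Zc|k|f g _ IHf _ IHg|f g _ IHf _ IHg] m.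
- rewrite mcoeffC; case: eqP => [->|_]; last exact: pow2Z2loc0.
  by exists c => //; rewrite halfsize1 mul1r.
- rewrite mcoeffZ mcoeffU1; case: eqP => [<-|_]; last first.
    by rewrite mulr0; exact: pow2Z2loc0.
  exists 1; first exact: (Z2loc_nat 1).
  by rewrite halfsizeU /= uphalf_double.
- by rewrite mcoeffD; exact: pow2Z2locD.
- rewrite malgME !raddf_sum; apply: pow2Z2loc_sum => m1 _.
  rewrite raddf_sum; apply: pow2Z2loc_sum => m2 _.
  rewrite /= mcoeffU; case: eqP => [<-|_]; last exact: pow2Z2loc0.
  by rewrite halfsizeM mulr1n; apply: pow2Z2locM; [exact: IHf | exact: IHg].
Qed.

End Z2loc.

Theorem theorem3p6 (R : realType) (n : nat) (f g : oddpoly R[i]) :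
  Delta f -> Delta g -> homogeneous n f -> homogeneous n g ->
  exists2 c : R[i], Z2loc c & pform f g = 2 ^+ (n - tri_root n) * c.
Proof.
move=> Df Dg hf _; apply: pow2Z2loc_sum => m /hf mn.
have [c Zc fE] := Delta_coeff R[i] f m Df.
have [d Zd gE] := Delta_coeff R[i] g m Dg.
(* The two coefficients each bring [2 ^ halfsize m]; together with [zpart m] they give
   [q * 2 ^ (n - tri_root n)]. *)
have /dvdnP[q zE] := dvdn_zpart m; rewrite mn in zE.
exists (c * d * q%:R); first by do !apply: Z2locM => //; exact: Z2loc_nat.
rewrite fE gE mulrACA -exprD addnn -mul2n (mulrC (2 ^+ _)) -natrX.
by rewrite -[LHS]mulrA -natrM zE natrM natrX [LHS]mulrA [LHS]mulrC.
Qed.
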